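(* Let $\mathcal{C}$ be a small preadditive category having at least one nonzero object, with set of objects $\mathcal{C}_0$, and let $\mathcal{G}:=\mathcal{C}_0\times\mathcal{C}_0$. The following statements are equivalent: (1) $\mathcal{C}$ is a division category. (2) $R[\mathcal{C}]$ is a $\mathcal{G}$-graded division ring. (3) Every functor $F\in\mathrm{Fun}(\mathcal{C}^{op},\mathcal{A}b)$ is free and all bases of $F$ (consisting of nonzero elements) have the same cardinality. (4) $\mathcal{C}$ is a semisimple category and $\mathcal{C}(A,A)$ is a division ring for each nonzero object $A\in\mathcal{C}_0$. (5) There exists a family $\{\mathcal{C}_j:j\in J\}$ of simple division categories such that $\mathcal{C}=\coprod_{j\in J}\mathcal{C}_j$.
   Context: A small preadditive category $\mathcal{C}$ has a set of objects $\mathcal{C}_0$ and abelian groups $\mathcal{C}(A,B)$ of morphisms $A\to B$ with $\mathbb{Z}$-bilinear composition; $I_A$ is the identity of $A$, and $A$ is nonzero if $I_A\neq0$. A preadditive category with a nonzero object is a division category if each of its nonzero morphisms is an isomorphism. An ideal of $\mathcal{C}$ is an additive subfunctor of $\mathcal{C}(-,-):\mathcal{C}^{op}\times\mathcal{C}\to\mathcal{A}b$ ($\mathcal{A}b$ the category of abelian groups); $\mathcal{C}$ is simple if its only nonzero ideal is $\mathcal{C}(-,-)$. The coproduct $\coprod_j\mathcal{C}_j$ of preadditive categories has as objects the disjoint union of the objects of the $\mathcal{C}_j$, each $\mathcal{C}_j$ being a full subcategory, with zero morphism groups between objects of different $\mathcal{C}_j$'s. $\mathrm{Fun}(\mathcal{C}^{op},\mathcal{A}b)$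 is the category of additive contravariant functors $\mathcal{C}\to\mathcal{A}b$. A basis of $F$ is a sequence $(x_i)_{i\in I}\in\prod_{i\in I}F(A_i)$, with $(A_i)_{i\in I}\in\mathcal{C}_0^I$, such that for all $A\in\mathcal{C}_0$ and $x\in F(A)$ there is a unique $(\lambda_i)\in\bigoplus_{i\in I}\mathcal{C}(A,A_i)$ with $x=\sum_iF(\lambda_i)(x_i)$; $F$ is free if it has a basis. $\mathcal{C}$ is a semisimple category if every representable functor $\mathcal{C}(-,A)$ is a semisimple object (a coproduct of simple objects) of $\mathrm{Fun}(\mathcal{C}^{op},\mathcal{A}b)$. $\mathcal{G}=\mathcal{C}_0\times\mathcal{C}_0$ is the groupoid with $r(Y,X)=Y$, $d(Y,X)=X$, $(Z,Y)(Y,X)=(Z,X)$, $(Y,X)^{-1}=(X,Y)$ and idempotents $\varepsilon_A=(A,A)$. $R=R[\mathcal{C}]=\bigoplus_{A,B}\mathcal{C}(A,B)$ is the ring with product $fg=f\circ g$ when the composition makes sense and $0$ otherwise; it is $\mathcal{G}$-graded by $R_{(A,B)}=\mathcal{C}(B,A)$, and $1_{\varepsilon_A}=I_A$. It is a $\mathcal{G}$-graded division ring if it is nonzero and each nonzero $a\in R_\gamma$ has $a^{-1}\in R_{\gamma^{-1}}$ with $aa^{-1}=1_{r(\gamma)}$ and $a^{-1}a=1_{d(\gamma)}$. *)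

(* Defs.v *)
From HB Require Import structures.
From mathcomp Require Import all_boot all_algebra finmap.
From mathcomp Require Import mathcomp_extra boolp classical_sets functions.
From mathcomp Require Import cardinality fsbigop.

Set Implicit Arguments.
Unset Strict Implicit.
Unset Printing Implicit Defensive.

Import GRing.Theory.

Local Open Scope classical_set_scope.
Local Open Scope ring_scope.

Declare Scope preadd_scope.
Local Open Scope preadd_scope.

Record dsum (I : Type) (M : I -> zmodType) := DSum {
  dsum_fun :> forall i, M i;
  dsum_finite : finite_set [set i | dsum_fun i <> 0] }.

Section DirectSum.
Variables (I : Type) (M : I -> zmodType).
Implicit Types x y z : dsum M.

Lemma dsumP x y : (forall i, x i = y i) -> x = y.
Proof.
case: x y => [f ff] [g gf] /= fg.
have efg : f = g by apply: functional_extensionality_dep.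
by subst g; congr DSum; exact: Prop_irrelevance.
Qed.

Lemma dsum_zero_finite : finite_set [set i | (0 : M i) <> 0].
Proof. by apply: (sub_finite_set _ (finite_set0 I)) => i /=. Qed.
Definition dsum_zero : dsum M := DSum dsum_zero_finite.

Lemma dsum_opp_finite x : finite_set [set i | - x i <> 0].
Proof.
apply: sub_finite_set (dsum_finite x) => i /= xi xi0.
by apply: xi; rewrite xi0 oppr0.
Qed.
Definition dsum_opp x : dsum M := DSum (dsum_opp_finite x).

Lemma dsum_add_finite x y : finite_set [set i | x i + y i <> 0].
Proof.
apply: (@sub_finite_set _ _ ([set i | x i <> 0] `|` [set i | y i <> 0])).
  move=> i /= xyi; apply: contrapT => /not_orP [/contrapT xi /contrapT yi].
  by apply: xyi; rewrite xi yi addr0.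
by rewrite finite_setU; split; exact: dsum_finite.
Qed.
Definition dsum_add x y : dsum M := DSum (dsum_add_finite x y).

HB.instance Definition _ := gen_eqMixin (dsum M).
HB.instance Definition _ := gen_choiceMixin (dsum M).

Lemma dsum_addA : associative dsum_add.
Proof. by move=> x y z; apply: dsumP => i /=; rewrite addrA. Qed.
Lemma dsum_addC : commutative dsum_add.
Proof. by move=> x y; apply: dsumP => i /=; rewrite addrC. Qed.
Lemma dsum_add0 : left_id dsum_zero dsum_add.
Proof. by move=> x; apply: dsumP => i /=; rewrite add0r. Qed.
Lemma dsum_addN : left_inverse dsum_zero dsum_opp dsum_add.
Proof. by move=> x; apply: dsumP => i /=; rewrite addNr. Qed.

HB.instance Definition _ := GRing.isZmodule.Build (dsum M)
  dsum_addA dsum_addC dsum_add0 dsum_addN.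

Lemma dsumDE x y i : (x + y) i = x i + y i. Proof. by []. Qed.
Lemma dsumNE x i : (- x) i = - x i. Proof. by []. Qed.

Lemma dsum_sumE (J : Type) (r : seq J) (P : pred J) (F : J -> dsum M) i :
  (\sum_(j <- r | P j) F j) i = \sum_(j <- r | P j) F j i.
Proof. by apply: (big_morph (fun x : dsum M => x i)). Qed.

(* the element of the direct sum concentrated in degree [i] with value [m] *)
Definition dsum_at i (m : M i) j : M j :=
  if pselect (i = j) is left e then ecast j (M j) e m else 0.

Lemma dsum_at_finite i (m : M i) : finite_set [set j | dsum_at m j <> 0].
Proof.
apply: (sub_finite_set _ (finite_set1 i)) => j /=.
by rewrite /dsum_at; case: pselect.
Qed.
Definition dsum_in i (m : M i) : dsum M := DSum (dsum_at_finite m).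

Lemma dsum_inE i (m : M i) : dsum_in m i = m.
Proof.
by rewrite /= /dsum_at; case: pselect => // e; rewrite (Prop_irrelevance e erefl).
Qed.

Lemma dsum_in_neq i j (m : M i) : i <> j -> dsum_in m j = 0.
Proof. by move=> ij /=; rewrite /dsum_at; case: pselect. Qed.

End DirectSum.

Lemma fsum_list (I : Type) (V : zmodType) (F : I -> V) (r : seq {classic I}) :
    uniq r -> (forall i : I, F i <> 0 -> (i : {classic I}) \in r) ->
  \sum_(i \in [set: {classic I}]) F i = \sum_(i <- r) F i.
Proof.
move=> ur Fr; rewrite (fsbigE r) //.
  by apply: eq_bigl => i; rewrite in_setT.
by move=> i _ ir; apply: contrapT => /Fr; apply/negP.
Qed.

Record preadditive := Preadditive {
  ob :> Type;
  hom : ob -> ob -> zmodType;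
  comp : forall A B C : ob, hom B C -> hom A B -> hom A C;
  idm : forall A : ob, hom A A;
  compA : forall (A B C D : ob) (h : hom C D) (g : hom B C) (f : hom A B),
    comp h (comp g f) = comp (comp h g) f;
  comp1m : forall (A B : ob) (f : hom A B), comp (idm B) f = f;
  compm1 : forall (A B : ob) (f : hom A B), comp f (idm A) = f;
  compDl : forall (A B C : ob) (g g' : hom B C) (f : hom A B),
    comp (g + g') f = comp g f + comp g' f;
  compDr : forall (A B C : ob) (g : hom B C) (f f' : hom A B),
    comp g (f + f') = comp g f + comp g f' }.

Arguments idm {_} A.
Notation "g \oc f" := (comp g f)
  (at level 40, left associativity) : preadd_scope.

Section PreadditiveTheory.
Variable C : preadditive.

Lemma comp0m (A B D : C) (f : hom A B) : (0 : hom B D) \oc f = 0.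
Proof. by apply: (addrI (0 \oc f)); rewrite -compDl !addr0. Qed.

Lemma compm0 (A B D : C) (g : hom B D) : g \oc (0 : hom A B) = 0.
Proof. by apply: (addrI (g \oc 0)); rewrite -compDr !addr0. Qed.

Lemma comp_suml (A B D : C) (J : Type) (r : seq J) (G : J -> hom B D)
    (f : hom A B) :
  (\sum_(j <- r) G j) \oc f = \sum_(j <- r) (G j \oc f).
Proof.
apply: (big_morph (fun g : hom B D => g \oc f)); last exact: comp0m.
by move=> g g'; exact: compDl.
Qed.

Lemma comp_sumr (A B D : C) (J : Type) (r : seq J) (g : hom B D)
    (F : J -> hom A B) :
  g \oc (\sum_(j <- r) F j) = \sum_(j <- r) (g \oc F j).
Proof.
apply: (big_morph (fun f : hom A B => g \oc f)); last exact: compm0.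
by move=> f f'; exact: compDr.
Qed.

End PreadditiveTheory.

Definition nonzero_ob (C : preadditive) (A : C) : Prop := idm A <> 0.

Definition is_isom (C : preadditive) (A B : C) (f : hom A B) : Prop :=
  exists g : hom B A, g \oc f = idm A /\ f \oc g = idm B.

Definition division_category (C : preadditive) : Prop :=
  (exists A : C, nonzero_ob A) /\
  forall (A B : C) (f : hom A B), f <> 0 -> is_isom f.

Record ideal (C : preadditive) := Ideal {
  ideal_set : forall A B : C, set (hom A B);
  ideal0 : forall A B : C, ideal_set (0 : hom A B);
  idealB : forall (A B : C) (f g : hom A B),
    ideal_set f -> ideal_set g -> ideal_set (f - g);
  ideal_comp : forall (A' A B B' : C) (g : hom B B') (f : hom A B)
      (h : hom A' A),
    ideal_set f -> ideal_set (g \oc f \oc h) }.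

Definition nonzero_ideal (C : preadditive) (J : ideal C) : Prop :=
  exists (A B : C) (f : hom A B), ideal_set J f /\ f <> 0.

Definition full_ideal (C : preadditive) (J : ideal C) : Prop :=
  forall (A B : C) (f : hom A B), ideal_set J f.

Definition simple_category (C : preadditive) : Prop :=
  forall J : ideal C, nonzero_ideal J <-> full_ideal J.

Record add_functor (C D : preadditive) := AddFunctor {
  fun_ob :> C -> D;
  fun_hom : forall A B : C, {additive hom A B -> hom (fun_ob A) (fun_ob B)};
  fun_id : forall A : C, fun_hom A A (idm A) = idm (fun_ob A);
  fun_comp : forall (A B E : C) (g : hom B E) (f : hom A B),
    fun_hom A E (g \oc f) = fun_hom B E g \oc fun_hom A B f }.

(* [C] is, up to renaming of objects and morphisms, the coproduct of the
   [Cj j]: its objects are the disjoint union of theirs, each [Cj j] is a full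
   subcategory, and there are no nonzero morphisms between distinct [Cj]'s. *)
Definition is_coproduct_category (J : Type) (Cj : J -> preadditive)
    (C : preadditive) : Prop :=
  exists incl : forall j, add_functor (Cj j) C,
  [/\ bijective (fun s : {j : J & Cj j} => incl (tag s) (tagged s)),
      forall j (A B : Cj j), bijective (fun_hom (incl j) A B)
    & forall i j (A : Cj i) (B : Cj j), i <> j ->
        forall f : hom (incl i A) (incl j B), f = 0].

Definition endo (C : preadditive) (A : C) : Type := hom A A.

Section Endo.
Variables (C : preadditive) (A : C).

HB.instance Definition _ := GRing.Zmodule.copy (endo A) (hom A A).

HB.instance Definition _ := GRing.Zmodule_isPzRing.Build (endo A)
  (@compA C A A A A) (@comp1m C A A) (@compm1 C A A)
  (fun f g h => @compDl C A A A f g h) (@compDr C A A A).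

End Endo.

Definition division_ring (D : pzRingType) : Prop :=
  (1 : D) <> 0 /\ forall x : D, x <> 0 -> exists y : D, y * x = 1 /\ x * y = 1.

Record functorAb (C : preadditive) := FunctorAb {
  fobj :> C -> zmodType;
  fmap : forall A B : C, hom A B -> {additive fobj B -> fobj A};
  fmap1 : forall (A : C) (x : fobj A), fmap (idm A) x = x;
  fmapM : forall (A B D : C) (g : hom B D) (f : hom A B) (x : fobj D),
    fmap (g \oc f) x = fmap f (fmap g x);
  fmapD : forall (A B : C) (f g : hom A B) (x : fobj B),
    fmap (f + g) x = fmap f x + fmap g x }.

Record nat_trans (C : preadditive) (F G : functorAb C) := NatTrans {
  nt :> forall A : C, {additive F A -> G A};
  nt_natural : forall (A B : C) (f : hom A B) (x : F B),
    nt A (fmap F f x) = fmap G f (nt B x) }.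

Section FunctorCategory.
Variable C : preadditive.
Implicit Types F G H S : functorAb C.

Definition nt_eq F G (a b : nat_trans F G) : Prop :=
  forall (A : C) (x : F A), a A x = b A x.

Lemma nt_id_natural F (A B : C) (f : hom A B) (x : F B) :
  (idfun : {additive F A -> F A}) (fmap F f x) = fmap F f x.
Proof. by []. Qed.
Definition nt_id F : nat_trans F F :=
  @NatTrans C F F (fun A => idfun : {additive F A -> F A}) (@nt_id_natural F).

Lemma nt_comp_natural F G H (b : nat_trans G H) (a : nat_trans F G)
    (A B : C) (f : hom A B) (x : F B) :
  (b A \o a A : {additive F A -> H A}) (fmap F f x)
  = fmap H f ((b B \o a B) x).
Proof. by rewrite /= !nt_natural. Qed.
Definition nt_comp F G H (b : nat_trans G H) (a : nat_trans F G) :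
    nat_trans F H :=
  @NatTrans C F H (fun A => b A \o a A : {additive F A -> H A})
    (@nt_comp_natural F G H b a).

Definition nt_mono F G (m : nat_trans F G) : Prop :=
  forall H (a b : nat_trans H F),
    nt_eq (nt_comp m a) (nt_comp m b) -> nt_eq a b.

Definition nt_isom F G (m : nat_trans F G) : Prop :=
  exists n : nat_trans G F,
    nt_eq (nt_comp n m) (nt_id F) /\ nt_eq (nt_comp m n) (nt_id G).

Definition zero_functor F : Prop := forall (A : C) (x : F A), x = 0.

(* the subobjects of [F] are [0] and [F], and these are distinct *)
Definition simple_functor F : Prop :=
  ~ zero_functor F /\
  forall G (m : nat_trans G F), nt_mono m -> zero_functor G \/ nt_isom m.

Definition is_coproduct_functor (I : Type) (S : I -> functorAb C) F
    (u : forall i, nat_trans (S i) F) : Prop :=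
  forall G (g : forall i, nat_trans (S i) G),
    exists h : nat_trans F G,
      (forall i, nt_eq (nt_comp h (u i)) (g i)) /\
      forall h' : nat_trans F G,
        (forall i, nt_eq (nt_comp h' (u i)) (g i)) -> nt_eq h' h.

Definition semisimple_functor F : Prop :=
  exists (I : Type) (S : I -> functorAb C) (u : forall i, nat_trans (S i) F),
    (forall i, simple_functor (S i)) /\ is_coproduct_functor u.

Definition is_basis F (I : Type) (A_ : I -> C) (x_ : forall i, F (A_ i)) :
    Prop :=
  forall (A : C) (x : F A),
    exists! l : dsum (fun i => hom A (A_ i)),
      x = \sum_(i \in [set: {classic I}]) fmap F (l i) (x_ i).

Definition free_functor F : Prop :=
  exists (I : Type) (A_ : I -> C) (x_ : forall i, F (A_ i)), is_basis x_.

(* A basis may contain any number of zero elements, located at zero objects,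
   so only bases with nonzero elements are compared. *)
Definition bases_equipotent F : Prop :=
  forall (I J : Type) (A_ : I -> C) (B_ : J -> C)
      (x_ : forall i, F (A_ i)) (y_ : forall j, F (B_ j)),
    is_basis x_ -> is_basis y_ ->
    (forall i, x_ i <> 0) -> (forall j, y_ j <> 0) ->
    ([set: I] #= [set: J])%card.

End FunctorCategory.

Section Representable.
Variables (C : preadditive) (A : C).

Section Precomp.
Variables (X Y : C) (f : hom X Y).
Definition precomp (g : hom Y A) : hom X A := g \oc f.
Lemma precomp_zmod : zmod_morphism precomp.
Proof.
move=> g h; apply: (addIr (precomp h)).
by rewrite /precomp -compDl !subrK.
Qed.
HB.instance Definition _ :=
  GRing.isZmodMorphism.Build (hom Y A) (hom X A) precomp precomp_zmod.
End Precomp.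

Definition representable : functorAb C :=
  @FunctorAb C (fun X => hom X A)
    (fun X Y f => precomp f : {additive hom Y A -> hom X A})
    (fun X g => compm1 g)
    (fun X Y Z g f h => compA h g f)
    (fun X Y f g h => compDr h f g).

End Representable.

Definition semisimple_category (C : preadditive) : Prop :=
  forall A : C, semisimple_functor (representable A).

(* [gmul g h] is defined only when [gdom g = gran h]; [gid e] is the idempotent
   attached to the object [e]. *)
Record groupoid := Groupoid {
  gobj : Type;
  garr :> Type;
  gran : garr -> gobj;
  gdom : garr -> gobj;
  gid : gobj -> garr;
  ginv : garr -> garr;
  gmul : forall g h : garr, gdom g = gran h -> garr;
  gran_id : forall e, gran (gid e) = e;
  gdom_id : forall e, gdom (gid e) = e;
  gran_inv : forall g, gran (ginv g) = gdom g;
  gdom_inv : forall g, gdom (ginv g) = gran g;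
  gran_mul : forall g h (gh : gdom g = gran h), gran (gmul gh) = gran g;
  gdom_mul : forall g h (gh : gdom g = gran h), gdom (gmul gh) = gdom h;
  gmulA : forall g h k (gh : gdom g = gran h) (hk : gdom h = gran k)
    (g_hk : gdom g = gran (gmul hk)) (gh_k : gdom (gmul gh) = gran k),
    gmul g_hk = gmul gh_k;
  gmul1g : forall g (e : gdom (gid (gran g)) = gran g), gmul e = g;
  gmulg1 : forall g (e : gdom g = gran (gid (gdom g))), gmul e = g;
  gmulVg : forall g (e : gdom (ginv g) = gran g), gmul e = gid (gdom g);
  gmulgV : forall g (e : gdom g = gran (ginv g)), gmul e = gid (gran g) }.

(* An associative ring, not necessarily unital, that is the direct sum of
   subgroups [gr_part g], with a local identity [gr_one e] for each object. *)
Record graded_ring (G : groupoid) := GradedRing {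
  gr_sort :> zmodType;
  gr_mul : gr_sort -> gr_sort -> gr_sort;
  gr_mulA : associative gr_mul;
  gr_mulDl : left_distributive gr_mul +%R;
  gr_mulDr : right_distributive gr_mul +%R;
  gr_part : G -> set gr_sort;
  gr_part0 : forall g, gr_part g 0;
  gr_partB : forall g x y, gr_part g x -> gr_part g y -> gr_part g (x - y);
  gr_decomp : forall x, exists! x_ : G -> gr_sort,
    [/\ finite_set [set g | x_ g <> 0], forall g, gr_part g (x_ g)
      & x = \sum_(g \in [set: {classic G}]) x_ g];
  gr_part_mul : forall g h (gh : gdom g = gran h) x y,
    gr_part g x -> gr_part h y -> gr_part (gmul gh) (gr_mul x y);
  gr_part_mul0 : forall g h x y, gdom g <> gran h ->
    gr_part g x -> gr_part h y -> gr_mul x y = 0;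
  gr_one : gobj G -> gr_sort;
  gr_part_one : forall e, gr_part (gid e) (gr_one e);
  gr_mul1x : forall g x, gr_part g x -> gr_mul (gr_one (gran g)) x = x;
  gr_mulx1 : forall g x, gr_part g x -> gr_mul x (gr_one (gdom g)) = x }.

Definition graded_division_ring (G : groupoid) (R : graded_ring G) : Prop :=
  (exists x : R, x <> 0) /\
  forall (g : G) (a : R), gr_part g a -> a <> 0 ->
    exists b : R,
      [/\ gr_part (ginv g) b, gr_mul a b = gr_one R (gran g)
        & gr_mul b a = gr_one R (gdom g)].

Section PairGroupoid.
Variable X : Type.

Definition pair_mul (g h : X * X) (_ : g.2 = h.1) : X * X := (g.1, h.2).

Lemma pair_mul1 (g : X * X) (e : g.1 = g.1) :
  @pair_mul (g.1, g.1) g e = g.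
Proof. by case: g e. Qed.
Lemma pair_mul1r (g : X * X) (e : g.2 = g.2) :
  @pair_mul g (g.2, g.2) e = g.
Proof. by case: g e. Qed.

Definition pair_groupoid : groupoid :=
  @Groupoid X (X * X) fst snd (fun A => (A, A)) (fun g => (g.2, g.1)) pair_mul
    (fun=> erefl) (fun=> erefl) (fun=> erefl) (fun=> erefl)
    (fun _ _ _ => erefl) (fun _ _ _ => erefl)
    (fun _ _ _ _ _ _ _ => erefl) pair_mul1 pair_mul1r
    (fun _ _ => erefl) (fun _ _ => erefl).

End PairGroupoid.

Section CategoryRing.
Variable C : preadditive.

(* the component of degree [(A, B)] is [hom B A] *)
Definition cring_part (p : C * C) : zmodType := hom p.2 p.1.
Definition cring := dsum cring_part.
HB.instance Definition _ := GRing.Zmodule.on cring.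
Implicit Types f g h : cring.

Definition cring_mul_fun f g (p : C * C) : cring_part p :=
  \sum_(Y \in [set: {classic (ob C)}]) (f (p.1, Y) \oc g (Y, p.2) : hom p.2 p.1).

Lemma cring_mul_list f g (r : seq {classic (ob C)}) p : uniq r ->
    (forall Y : C, f (p.1, Y) <> 0 -> g (Y, p.2) <> 0 ->
       (Y : {classic (ob C)}) \in r) ->
  cring_mul_fun f g p = \sum_(Y <- r) (f (p.1, Y) \oc g (Y, p.2) : hom p.2 p.1).
Proof.
move=> ur fgr; apply: fsum_list => // Y fgY; apply: fgr => f0; apply: fgY.
  by rewrite f0 comp0m.
by rewrite f0 compm0.
Qed.

Lemma cring_mul_finite f g : finite_set [set p | cring_mul_fun f g p <> 0].
Proof.
pose S h := [set p : C * C | h p <> 0].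
apply: (@sub_finite_set _ _ ((fun pq => (pq.1.1, pq.2.2)) @` (S f `*` S g))).
  move=> p /= fgp; apply: contrapT => np; apply: fgp.
  rewrite (@cring_mul_list f g [::]) ?big_nil // => Y fY gY; exfalso.
  by apply: np; exists ((p.1, Y), (Y, p.2)) => //=; case: (p).
by apply/finite_image/finite_setX; exact: dsum_finite.
Qed.

(* [fg] is the composite when defined and [0] otherwise, extended biadditively;
   see [cring_mul_in] and [cring_mul_in0] *)
Definition cring_mul f g : cring := DSum (cring_mul_finite f g).

Lemma cring_objects (s : seq cring) :
  exists2 r : seq {classic (ob C)}, uniq r &
    forall f (p : C * C), f \in s -> f p <> 0 ->
      (p.1 : {classic (ob C)}) \in r /\ (p.2 : {classic (ob C)}) \in r.
Proof.
elim: s => [|f s [r ur rP]]; first by exists [::].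
have /finite_fsetP [X eX] :=
  finite_image (fst : C * C -> {classic (ob C)}) (dsum_finite f).
have /finite_fsetP [Y eY] :=
  finite_image (snd : C * C -> {classic (ob C)}) (dsum_finite f).
exists (undup (r ++ X ++ Y)); first exact: undup_uniq.
move=> g p; rewrite inE => /predU1P[->|gs] gp; rewrite !mem_undup !mem_cat.
  have p1 : [set` X] (p.1 : {classic (ob C)}) by rewrite -eX; exists p.
  have p2 : [set` Y] (p.2 : {classic (ob C)}) by rewrite -eY; exists p.
  by split; rewrite ?[_ \in X]p1 ?[_ \in Y]p2 ?orbT.
by have [-> ->] := rP g p gs gp.
Qed.

Lemma cring_mulA : associative cring_mul.
Proof.
move=> f g h; have [r ur rP] := cring_objects [:: f; g; h].
have rf p : f p <> 0 -> p.1 \in r /\ p.2 \in r by apply: rP; rewrite !inE eqxx.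
have rg p : g p <> 0 -> p.1 \in r /\ p.2 \in r by apply: rP; rewrite !inE eqxx orbT.
have rh p : h p <> 0 -> p.1 \in r /\ p.2 \in r by apply: rP; rewrite !inE eqxx !orbT.
apply: dsumP => p /=.
rewrite (@cring_mul_list f _ r) //; last by move=> Y /rf [].
rewrite (@cring_mul_list _ h r) //; last by move=> Y _ /rh [].
under eq_bigr => Y _.
  rewrite /= (@cring_mul_list g h r) //=; last by move=> Z /rg [].
  rewrite comp_sumr; under eq_bigr do rewrite compA; over.
rewrite exchange_big /=; apply: eq_bigr => Z _.
rewrite (@cring_mul_list f g r) //=; last by move=> Y /rf [].
by rewrite comp_suml.
Qed.

Lemma cring_mulDl : left_distributive cring_mul +%R.
Proof.
move=> f g h; have [r ur rP] := cring_objects [:: f; g; h].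
have rh p : h p <> 0 -> p.1 \in r /\ p.2 \in r by apply: rP; rewrite !inE eqxx !orbT.
apply: dsumP => p; rewrite dsumDE /=.
rewrite !(@cring_mul_list _ h r) //; do ?by move=> Y _ /rh [].
by rewrite -big_split /=; apply: eq_bigr => Y _; rewrite compDl.
Qed.

Lemma cring_mulDr : right_distributive cring_mul +%R.
Proof.
move=> f g h; have [r ur rP] := cring_objects [:: f; g; h].
have rf p : f p <> 0 -> p.1 \in r /\ p.2 \in r by apply: rP; rewrite !inE eqxx.
apply: dsumP => p; rewrite dsumDE /=.
rewrite !(@cring_mul_list f _ r) //; do ?by move=> Y /rf [].
by rewrite -big_split /=; apply: eq_bigr => Y _; rewrite compDr.
Qed.

Definition cring_homog (p : C * C) : set cring :=
  [set f | forall q, q <> p -> f q = 0].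

Lemma cring_homog0 p : cring_homog p 0.
Proof. by []. Qed.

Lemma cring_homogB p f g :
  cring_homog p f -> cring_homog p g -> cring_homog p (f - g).
Proof.
by move=> fp gp q qp; rewrite dsumDE dsumNE fp // gp // subr0.
Qed.

Lemma cring_homog_in p (m : cring_part p) : cring_homog p (dsum_in m).
Proof. by move=> q /nesym; exact: dsum_in_neq. Qed.

Lemma cring_homogE p f : cring_homog p f -> f = dsum_in (f p).
Proof.
move=> fp; apply: dsumP => q; have [<-|pq] := pselect (p = q).
  by rewrite dsum_inE.
by rewrite dsum_in_neq // fp //; exact: nesym.
Qed.

Lemma cring_decomp f : exists! f_ : C * C -> cring,
  [/\ finite_set [set p | f_ p <> 0], forall p, cring_homog p (f_ p)
    & f = \sum_(p \in [set: {classic (C * C)%type}]) f_ p].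
Proof.
have sumE (f_ : C * C -> cring) : finite_set [set p | f_ p <> 0] ->
    (forall p, cring_homog p (f_ p)) ->
    forall q, (\sum_(p \in [set: {classic (C * C)%type}]) f_ p) q = f_ q q.
  move=> ff fh q; have [X eX] := (@finite_fsetP {classic (C * C)%type} _).1 ff.
  have inX p : f_ p <> 0 -> (p : {classic (C * C)%type}) \in X.
    by move=> fp; have : [set` X] p by rewrite -eX.
  rewrite (@fsum_list (C * C) _ f_ X) ?fset_uniq // dsum_sumE.
  have [qX|qX] := boolP ((q : {classic (C * C)%type}) \in X).
    rewrite (big_rem _ qX) /= big1_seq ?addr0 // => p /andP[_].
    rewrite mem_rem_uniq ?fset_uniq // => /andP[/eqP pq _].
    by apply: fh; exact: nesym.
  rewrite big1_seq; last first.
    move=> p /andP[_ pX]; apply: fh => qp.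
    by move: qX; rewrite qp pX.
  by have [->//|/inX] := pselect (f_ q = 0); rewrite (negbTE qX).
pose c p : cring := dsum_in (f p).
have cf : finite_set [set p | c p <> 0].
  apply: sub_finite_set (dsum_finite f) => p /= cp fp; apply: cp.
  rewrite /c fp; apply: dsumP => q; have [<-|pq] := pselect (p = q).
    by rewrite dsum_inE.
  by rewrite dsum_in_neq.
have ch p : cring_homog p (c p) by exact: cring_homog_in.
exists c; split.
  by split=> //; apply: dsumP => q; rewrite sumE // dsum_inE.
move=> d [df dh fE]; apply: functional_extensionality_dep => p.
by rewrite [RHS](cring_homogE (dh p)) /c fE sumE.
Qed.

Lemma cring_mul_homog p q (pq : p.2 = q.1) f g :
  cring_homog p f -> cring_homog q g ->
  cring_homog (pair_mul pq) (cring_mul f g).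
Proof.
move=> fp gq s sp /=; rewrite (@cring_mul_list f g [::]) ?big_nil //.
move=> Y fY gY; exfalso; apply: sp; rewrite /pair_mul.
have <- : (s.1, Y) = p by apply: contrapT => /fp.
have <- : (Y, s.2) = q by apply: contrapT => /gq.
by case: (s).
Qed.

Lemma cring_mul_homog0 p q f g : p.2 <> q.1 ->
  cring_homog p f -> cring_homog q g -> cring_mul f g = 0.
Proof.
move=> pq fp gq; apply: dsumP => s /=.
rewrite (@cring_mul_list f g [::]) ?big_nil // => Y fY gY; exfalso; apply: pq.
have <- : (s.1, Y) = p by apply: contrapT => /fp.
by have <- : (Y, s.2) = q by apply: contrapT => /gq.
Qed.

Lemma cring_mul_in (X Y Z : C) (f : hom Y Z) (g : hom X Y) :
  cring_mul (@dsum_in _ cring_part (Z, Y) f) (@dsum_in _ cring_part (Y, X) g)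
  = @dsum_in _ cring_part (Z, X) (f \oc g).
Proof.
rewrite [LHS](@cring_homogE (Z, X)); last first.
  exact: (@cring_mul_homog (Z, Y) (Y, X) erefl (dsum_in _) (dsum_in _)
    (cring_homog_in _) (cring_homog_in _)).
congr dsum_in; rewrite [LHS](@cring_mul_list _ _ [:: Y]) //; last first.
  move=> Y' fY _; rewrite inE; apply/eqP; apply: contrapT => YY'.
  by apply: fY; rewrite dsum_in_neq //= => -[] /esym.
by rewrite big_seq1 !dsum_inE.
Qed.

Lemma cring_mul_in0 (X Y Y' Z : C) (f : hom Y Z) (g : hom X Y') : Y <> Y' ->
  cring_mul (@dsum_in _ cring_part (Z, Y) f) (@dsum_in _ cring_part (Y', X) g)
  = 0.
Proof.
by move=> YY'; apply: (@cring_mul_homog0 (Z, Y) (Y', X)) => //;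
  exact: cring_homog_in.
Qed.

Definition cring_one (A : C) : cring := @dsum_in _ cring_part (A, A) (idm A).

Lemma cring_mul1 p f : cring_homog p f -> cring_mul (cring_one p.1) f = f.
Proof.
case: p => A B /cring_homogE ->; rewrite cring_mul_in; congr dsum_in.
exact: comp1m.
Qed.

Lemma cring_mul1r p f : cring_homog p f -> cring_mul f (cring_one p.2) = f.
Proof.
case: p => A B /cring_homogE ->; rewrite cring_mul_in; congr dsum_in.
exact: compm1.
Qed.

Definition category_ring : graded_ring (pair_groupoid C) :=
  @GradedRing (pair_groupoid C) cring cring_mul
    cring_mulA cring_mulDl cring_mulDr cring_homog
    cring_homog0 cring_homogB cring_decomp
    cring_mul_homog cring_mul_homog0
    cring_one (fun A => @cring_homog_in (A, A) (idm A))
    cring_mul1 cring_mul1r.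

End CategoryRing.

(* Main.v *)
Require Import Defs.
From HB Require Import structures.
From mathcomp Require Import all_boot ssralg generic_quotient ring_quotient.
From mathcomp Require Import finmap.
From mathcomp Require Import mathcomp_extra boolp classical_sets functions.
From mathcomp Require Import cardinality fsbigop.

Set Implicit Arguments.
Unset Strict Implicit.
Unset Printing Implicit Defensive.

Import GRing.Theory.

Local Open Scope classical_set_scope.
Local Open Scope ring_scope.
Local Open Scope preadd_scope.
Local Open Scope quotient_scope.

(** Every condition is compared with the first one, that nonzero morphisms are
invertible.

Division implies free.  An additive contravariant functor over a division
category behaves like a vector space.  The subfunctor generated by a set of
elements, taken over all objects at once, is a finitary closure operator, and
invertibility of nonzero scalars gives it the exchange property
([span_cl_exchange]).  Both halves of the claim then follow from the theory of
such closure operators: Zorn's lemma gives a basis ([basis_set_exists]), and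
any two bases are equipotent ([basis_set_card_eq]), by Steinitz exchange when
one is finite and otherwise because a basis B' that is infinite satisfies
|B' x N| = |B'| and every element of another basis occurs in the finite support
of some element of B'.

Free implies division.  Let f : A -> B be nonzero, and let M be the subfunctor
of hom(-,B) formed by the multiples of f.  Bases of M and of hom(-,B)/M, freed
of their zero elements, glue to a basis of hom(-,B) ([extension_spanning],
[extension_independent]).  The identity of B alone is another basis, so
the glued basis has one element.  It comes from M, since M contains f; hence
hom(-,B)/M = 0, so the identity of B lies in M: f has a right inverse.  When
every nonzero morphism has a right inverse, every nonzero morphism is
invertible ([right_inverses_division]).

Semisimplicity.  Over a division category a nonzero representable functor is
simple.  Conversely, a simple summand S of hom(-,B) corresponds by the Yoneda
lemma to a nonzero idempotent of the division ring C(B,B), that is, to the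
identity, so hom(-,B) is a copy of S and simple
([semisimple_representable_simple]); thus the multiples of a nonzero f : A -> B
exhaust hom(-,B) and f has a right inverse again.

Coproducts.  Over a division category, being linked by a nonzero morphism is an
equivalence relation on nonzero objects, and its classes, one of them enlarged
by the zero objects, are the components ([component_coproduct]).  The graded ring condition is the definition of a
division category read in homogeneous components. *)

(** * Bases of finitary closure operators with exchange *)

Lemma infinite_sequence (T : Type) (D : set T) : infinite_set D ->
  exists2 f : nat -> T, injective f & forall n, D (f n).
Proof.
move=> /infiniteP/card_leP [f]; exists (fun n => set_val (f (to_setT n))).
  move=> m n /val_inj e; have := @inj _ _ _ f (to_setT m) (to_setT n).
  by rewrite !inE => /(_ I I e) [].
by move=> n; exact: set_valP.
Qed.

(** The inequality |D x N| <= |D| for infinite D.  A maximal disjoint family of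
injective sequences in D misses only finitely many elements of D, and the
missed ones are absorbed in one of the sequences. *)
Lemma infinite_absorbs_nat (T : Type) (D : set T) : infinite_set D ->
  exists g : T -> nat -> T, forall x m, D x ->
    D (g x m) /\ forall y n, D y -> g x m = g y n -> x = y /\ m = n.
Proof.
move=> Dinf.
pose good (s : nat -> T) := injective s /\ forall m, D (s m).
pose P (S : set (nat -> T)) := (S `<=` good) /\
  forall s s', S s -> S s' -> forall m m', s m = s' m' -> s = s'.
have [F FP Ftot|S [[Sgood Sdisj] Smax]] := @Zorn_bigcup _ P.
  split=> [s [X FX Xs]|s s' [X FX Xs] [Y FY Ys']]; first exact: (FP X FX).1.
  have [XY|YX] := Ftot X Y FX FY.
    exact: (FP Y FY).2 (XY _ Xs) Ys'.
  exact: (FP X FX).2 Xs (YX _ Ys').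
pose cov := [set x | exists s m, S s /\ s m = x].
have restfin : finite_set (D `\` cov).
  apply: contrapT => /infinite_sequence [f finj fD].
  have Pf : P (S `|` [set f]).
    split=> [s [/Sgood//|->]|]; first by split=> // m; exact: (fD m).1.
    move=> s s' [Ss|->] [Ss'|->] m m' // e.
    - exact: Sdisj e.
    - by case: (fD m').2; exists s, m.
    - by case: (fD m).2; exists s', m'.
  apply: (Smax _ _ Pf); split; first exact: subsetUl.
  move=> /(_ _ (or_intror erefl)) Sf.
  by case: (fD 0%N).2; exists f, 0%N.
have [s0 Ss0] : exists s, S s.
  apply: contrapT => nS; apply: Dinf; apply: sub_finite_set restfin => x Dx.
  by split=> // -[s [m [Ss _]]]; apply: nS; exists s.
have /countable_injP[k kinj] := finite_set_countable restfin.
have /choice[pick pickP] x : exists p : (nat -> T) * nat,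
    cov x -> S p.1 /\ p.1 p.2 = x.
  have [[s [m sm]]|ncx] := pselect (cov x); first by exists (s, m).
  by exists (s0, 0%N).
(* a sequence absorbs N copies of itself, and s0 also the missed elements *)
pose g x (n : nat) : T :=
  if pselect (cov x) then (pick x).1 (choice.pickle (0%N, (pick x).2, n))
  else s0 (choice.pickle (1%N, k x, n)).
exists g => x m Dx; split.
  rewrite /g; case: pselect => [cx|?] /=.
    by have [/Sgood[]] := pickP _ cx.
  exact: (Sgood _ Ss0).2.
move=> y n Dy; rewrite /g; case: pselect => cx; case: pselect => cy /=.
- have [Sx ex] := pickP _ cx; have [Sy ey] := pickP _ cy.
  move=> e; have es := Sdisj _ _ Sx Sy _ _ e; rewrite -es in e ey.
  have /(pcan_inj choice.pickleK) [ep ->] := (Sgood _ Sx).1 _ _ e.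
  by rewrite -ex -ey ep.
- have [Sx ex] := pickP _ cx => e; have es := Sdisj _ _ Sx Ss0 _ _ e.
  by rewrite -es in e; have /(pcan_inj choice.pickleK) [] := (Sgood _ Sx).1 _ _ e.
- have [Sy ey] := pickP _ cy => e; have es := Sdisj _ _ Ss0 Sy _ _ e.
  by rewrite -es in e; have /(pcan_inj choice.pickleK) [] := (Sgood _ Ss0).1 _ _ e.
- move=> /((Sgood _ Ss0).1)/(pcan_inj choice.pickleK) [ke ->]; split=> //.
  by apply: kinj ke; rewrite inE.
Qed.

Lemma chain_finite_subset (T : eqType) (F : set (set T)) (X : set T)
    (s : seq T) :
  total_on F subset -> F X -> [set` s] `<=` \bigcup_(Y in F) Y ->
  exists Z, [/\ F Z, X `<=` Z & [set` s] `<=` Z].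
Proof.
move=> Ftot FX; elim: s => [|x s IHs] sF; first by exists X; split.
have [|Z [FZ XZ sZ]] := IHs.
  by move=> y ys; apply: sF; rewrite /= inE [_ \in s]ys orbT.
have [|Y FY Yx] := sF x; first by rewrite /= inE eqxx.
have [ZY|YZ] := Ftot Z Y FZ FY.
  exists Y; split=> //; first exact: subset_trans ZY.
  by move=> y; rewrite /= inE => /predU1P[->//|/sZ/ZY].
by exists Z; split=> // y; rewrite /= inE => /predU1P[->|/sZ//]; exact: YZ.
Qed.

Section Pregeometry.
Variables (T : choiceType) (cl : set T -> set T).
Hypothesis cl_ext : forall S, S `<=` cl S.
Hypothesis cl_closed : forall S R, S `<=` cl R -> cl S `<=` cl R.
Hypothesis cl_finitary : forall S x, cl S x ->
  exists2 s : seq T, [set` s] `<=` S & cl [set` s] x.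
Hypothesis cl_exchange : forall S x y,
  cl (S `|` [set y]) x -> ~ cl S x -> cl (S `|` [set x]) y.

Definition independent_set (B : set T) := forall x, B x -> ~ cl (B `\ x) x.
Definition basis_set (B : set T) := independent_set B /\ cl B = setT.

Lemma cl_mono S R : S `<=` R -> cl S `<=` cl R.
Proof. by move=> SR; apply: cl_closed => x /SR; exact: cl_ext. Qed.

Lemma basis_set_exists : exists B, basis_set B.
Proof.
have [F FP Ftot|B [Bind Bmax]] := @Zorn_bigcup _ independent_set.
  move=> x [X FX Xx] /cl_finitary [s sF sx].
  have sF' : [set` s] `<=` \bigcup_(Y in F) Y by move=> y /sF[].
  have [Z [FZ XZ sZ]] := chain_finite_subset Ftot FX sF'.
  apply: (FP Z FZ x (XZ x Xx)); apply: cl_mono sx => y ys.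
  by split; [exact: sZ|exact: (sF y ys).2].
exists B; split=> //; rewrite -subTset => x _; apply: contrapT => nBx.
have BxP : independent_set (B `|` [set x]).
  move=> y [By|->] hy; last first.
    by apply: nBx; apply: cl_mono hy => z [[//|->] zz]; case: zz.
  have yx : y <> x by move=> yx; apply: nBx; rewrite -yx; exact: cl_ext.
  have Bxy : cl ((B `\ y) `|` [set x]) y.
    by apply: cl_mono hy => z [[Bz|->] zy]; [left|right].
  apply: nBx; apply: cl_mono (cl_exchange Bxy (Bind _ By)).
  by move=> z [[]|->].
apply: (Bmax _ _ BxP); split=> [z Bz|/(_ x (or_intror erefl)) Bx]; first by left.
by apply: nBx; exact: cl_ext.
Qed.

(** Steinitz exchange, relative to a set [a] which collects the elements of [t]
that have already replaced an element of [s]. *)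
Lemma exchange_size (a : set T) (s t : seq T) : uniq t ->
    (forall x, x \in t -> ~ cl (a `|` ([set` t] `\ x)) x) ->
    (forall x, x \in t -> cl (a `|` [set` s]) x) ->
  (size t <= size s)%N.
Proof.
elim: s a t => [|y s IHs] a t ut tind tcl.
  case: t ut tind tcl => // x t _ /(_ x) tind /(_ x) tcl; exfalso.
  apply: tind; first exact: mem_head.
  by apply: cl_mono (tcl (mem_head _ _)) => z [az|//]; left.
have [ts|/existsNP[x /not_implyP[xt xs]]] :=
  pselect (forall x, x \in t -> cl (a `|` [set` s]) x).
  exact: leq_trans (IHs a t ut tind ts) _.
have ys : cl (a `|` [set` s] `|` [set x]) y.
  apply: cl_exchange xs; apply: cl_mono (tcl x xt) => z [az|]; first by left; left.
  by rewrite /= inE => /predU1P[->|zs]; [right|left; right].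
suff : (size (rem x t) <= size s)%N by rewrite size_rem // -ltnS; case: (t) xt.
apply: (IHs (a `|` [set x])); first exact: rem_uniq.
  move=> z; rewrite mem_rem_uniq // inE => /andP[zx zt] hz.
  apply: (tind z zt); apply: cl_mono hz => w [[aw|->]|[]].
  - by left.
  - by right; split=> // xz; rewrite xz eqxx in zx.
  - by rewrite /= mem_rem_uniq // inE => /andP[_ wt] wz; right.
move=> z; rewrite mem_rem_uniq // inE => /andP[_ zt].
apply: cl_closed (tcl z zt) => w [aw|]; first by apply: cl_ext; left; left.
rewrite /= inE => /predU1P[->|ws]; last by apply: cl_ext; right.
by apply: cl_mono ys => v [[av|vs]|->]; [left; left|right|left; right].
Qed.

(** For infinite B', an element x of B lies in the support of some y of B', for
otherwise B' would be contained in the closure of B minus x; the pair made of y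
and the position of x in that support determines x. *)
Lemma basis_set_card_le B B' : basis_set B -> basis_set B' -> (B #<= B')%card.
Proof.
move=> [Bind BT] [_ BT'].
have [|B'inf] := pselect (finite_set B').
  move=> /finite_fsetP [Y eY].
  have XY (X : {fset T}) : [set` X] `<=` B -> (#|` X| <= #|` Y|)%N.
    move=> XB; apply: (@exchange_size set0); rewrite ?fset_uniq //.
      move=> x xX hx; apply: (Bind x (XB x xX)).
      by apply: cl_mono hx => z [//|[zX zx]]; split=> //; exact: XB.
    by move=> x _; rewrite set0U -eY BT'.
  have Bfin : finite_set B.
    apply: contrapT => /(@infinite_set_fset _ _ (#|` Y|.+1)) [X /XY XY' YX].
    by have := leq_trans YX XY'; rewrite ltnn.
  have [X eX] := finite_fsetP.1 Bfin.
  have /card_eq_fsetP cX := erefl #|` X|; have /card_eq_fsetP cY := erefl #|` Y|.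
  by rewrite eX eY (card_le_eql cX) (card_le_eqr cY) card_le_II XY // eX.
have [g gP] := infinite_absorbs_nat B'inf.
have /choice[s sP] y : exists s : seq T, [set` s] `<=` B /\ cl [set` s] y.
  by have [s] := @cl_finitary B y ltac:(by rewrite BT); exists s.
have /choice[h hP] x : exists y, B x -> B' y /\ x \in s y.
  have [Bx|nBx] := pselect (B x); last by exists x.
  apply: contrapT => /forallNP nx; apply: (Bind x Bx).
  suff /cl_closed : B' `<=` cl (B `\ x) by apply; rewrite BT'.
  move=> y B'y; apply: cl_mono (sP y).2 => z zs; split; first exact: (sP y).1.
  by move=> zx; apply: (nx y) => _; rewrite -zx.
have /injfunPex[f] : exists2 f : T -> T, set_fun B B' f & set_inj B f.
  exists (fun x => g (h x) (index x (s (h x)))) => [x /hP[B'h _]|x y].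
    exact: (gP _ _ B'h).1.
  rewrite !inE => /hP[B'hx xs] /hP[B'hy ys] /((gP _ _ B'hx).2 _ _ B'hy) [e].
  by rewrite e in xs *; move=> /(congr1 (nth x (s (h y)))); rewrite !nth_index.
exact: inj_card_le f.
Qed.

Lemma basis_set_card_eq B B' : basis_set B -> basis_set B' -> (B #= B')%card.
Proof. by move=> bB bB'; rewrite card_eq_le !basis_set_card_le. Qed.

End Pregeometry.

(** * Generated subfunctors and bases *)

Section Span.
Variable C : preadditive.
Implicit Types F G : functorAb C.

(** Bases of a functor mix elements at different objects, so generation is
studied in the disjoint union of its values. *)
Definition elt F : Type := {A : C & F A}.
Definition Elt F (A : C) (x : F A) : elt F := existT _ A x.

Inductive span F (S : set (elt F)) : forall A : C, F A -> Prop :=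
| span0 A : span S (0 : F A)
| spanB A (x y : F A) : span S x -> span S y -> span S (x - y)
| span_gen A (t : elt F) (f : hom A (tag t)) :
    S t -> span S (fmap F f (tagged t)).

Lemma fmap_hom0 F (A B : C) (x : F B) : fmap F (0 : hom A B) x = 0.
Proof. by apply: (addIr (fmap F 0 x)); rewrite -fmapD !add0r. Qed.

Lemma spanN F S A (x : F A) : span S x -> span S (- x).
Proof. by move=> Sx; rewrite -sub0r; apply: spanB => //; exact: span0. Qed.

Lemma spanD F S A (x y : F A) : span S x -> span S y -> span S (x + y).
Proof. by move=> Sx Sy; rewrite -[y]opprK; apply: spanB => //; exact: spanN. Qed.

Lemma span_mem F (S : set (elt F)) t : S t -> span S (tagged t).
Proof. by move=> St; rewrite -[tagged t]fmap1; exact: span_gen. Qed.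

Lemma span_fmap F S A B (f : hom A B) (x : F B) :
  span S x -> span S (fmap F f x).
Proof.
move=> Sx; elim: Sx A f => {B x} [B|B x y _ Sx _ Sy|B t g St] A f.
- by rewrite raddf0; exact: span0.
- by rewrite raddfB; apply: spanB; [exact: Sx|exact: Sy].
- by rewrite -fmapM; exact: span_gen.
Qed.

Lemma span_closed F (S R : set (elt F)) :
  (forall t, S t -> span R (tagged t)) ->
  forall A (x : F A), span S x -> span R x.
Proof.
move=> SR A x; elim=> {A x} [A|A x y _ Rx _ Ry|A t g St]; first exact: span0.
  exact: spanB.
by apply: span_fmap; exact: SR.
Qed.

Lemma span_mono F (S R : set (elt F)) : S `<=` R ->
  forall A (x : F A), span S x -> span R x.
Proof. by move=> SR; apply: span_closed => t /SR; exact: span_mem. Qed.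

Lemma span_set0 F A (x : F A) : span set0 x -> x = 0.
Proof.
by elim=> {A x} [//|A x y _ -> _ ->|//]; rewrite subrr.
Qed.

Lemma span_setU F (S R : set (elt F)) A (x : F A) : span (S `|` R) x ->
  exists y z, [/\ span S y, span R z & x = y + z].
Proof.
elim=> {A x} [A|A x x' _ [y [z [Sy Rz ->]]] _ [y' [z' [Sy' Rz' ->]]]|A t f [St|Rt]].
- by exists 0, 0; split; rewrite ?addr0 //; exact: span0.
- exists (y - y'), (z - z'); split; [exact: spanB|exact: spanB|].
  by rewrite opprD addrACA.
- by exists (fmap F f (tagged t)), 0; split; [exact: span_gen|exact: span0|rewrite addr0].
- by exists 0, (fmap F f (tagged t)); split; [exact: span0|exact: span_gen|rewrite add0r].
Qed.

Lemma span_set1 F (t : elt F) A (x : F A) : span [set t] x ->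
  exists f : hom A (tag t), x = fmap F f (tagged t).
Proof.
elim=> {A x} [A|A x y _ [f ->] _ [g ->]|A u f ut].
- by exists 0; rewrite fmap_hom0.
- exists (f - g); apply: (addIr (fmap F g (tagged t))).
  by rewrite -fmapD !subrK.
- by move: f; rewrite ut => f; exists f.
Qed.

Lemma span_finitary F (S : set (elt F)) A (x : F A) : span S x ->
  exists2 s : seq {classic elt F}, [set` s] `<=` S & span [set` s] x.
Proof.
elim=> {A x} [A|A x y _ [s sS sx] _ [r rS ry]|A t f St].
- by exists [::] => //; exact: span0.
- exists (s ++ r); first by move=> t; rewrite /= mem_cat => /orP[/sS|/rS].
  by apply: spanB; [apply: span_mono sx|apply: span_mono ry] => t;
    rewrite /= mem_cat => ->; rewrite ?orbT.
- exists [:: t]; first by move=> u; rewrite /= inE => /eqP ->.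
  by apply: span_gen; rewrite /= inE eqxx.
Qed.

Definition elt_map F G (a : nat_trans F G) (t : elt F) : elt G :=
  Elt (a (tag t) (tagged t)).

Lemma span_image F G (a : nat_trans F G) S A (y : G A) :
  span (elt_map a @` S) y <-> exists2 x, span S x & a A x = y.
Proof.
split=> [|[x Sx <-{y}]].
  elim=> {A y} [A|A y y' _ [x Sx <-] _ [x' Sx' <-]|A u f [t St tu]].
  - by exists 0; rewrite ?raddf0 //; exact: span0.
  - by exists (x - x'); rewrite ?raddfB //; exact: spanB.
  - case: u / tu f => f.
    by exists (fmap F f (tagged t)); [exact: span_gen|rewrite nt_natural].
elim: Sx => {A x} [A|A x x' _ IHx _ IHx'|A t f St].
- by rewrite raddf0; exact: span0.
- by rewrite raddfB; exact: spanB.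
- rewrite nt_natural; have := @span_gen G (elt_map a @` S) A (elt_map a t) f.
  by apply; exists t.
Qed.

Section LinearCombinations.
Variables (F : functorAb C) (I : Type) (X : I -> elt F).

Definition lincomb A (l : dsum (fun i => hom A (tag (X i)))) : F A :=
  \sum_(i \in [set: {classic I}]) fmap F (l i) (tagged (X i)).

Lemma lincombE A (l : dsum (fun i => hom A (tag (X i)))) (r : seq {classic I}) :
  uniq r -> (forall i : I, l i <> 0 -> (i : {classic I}) \in r) ->
  lincomb l = \sum_(i <- r) fmap F (l i) (tagged (X i)).
Proof.
move=> ur lr; apply: fsum_list => // i li; apply: lr => li0.
by apply: li; rewrite li0 fmap_hom0.
Qed.

Lemma dsum_support (M : I -> zmodType) (l : dsum M) :
  exists2 r : seq {classic I}, uniq r &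
    forall i : I, l i <> 0 -> (i : {classic I}) \in r.
Proof.
have [r lr] := (@finite_seqP {classic I} _).1 (dsum_finite l).
exists (undup r) => [|i li]; first exact: undup_uniq.
by rewrite mem_undup; have : [set` r] i by rewrite -lr.
Qed.

Lemma lincombB A (l l' : dsum (fun i => hom A (tag (X i)))) :
  lincomb (l - l') = lincomb l - lincomb l'.
Proof.
have [r ur rl] := dsum_support l; have [r' ur' rl'] := dsum_support l'.
have us : uniq (undup (r ++ r')) by exact: undup_uniq.
have sl i : l i <> 0 -> (i : {classic I}) \in undup (r ++ r').
  by move=> /rl; rewrite mem_undup mem_cat => ->.
have sl' i : l' i <> 0 -> (i : {classic I}) \in undup (r ++ r').
  by move=> /rl'; rewrite mem_undup mem_cat orbC => ->.
rewrite !(lincombE us) // -?sumrB; last first.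
  move=> i; rewrite dsumDE dsumNE => ll'; have [li|/sl//] := pselect (l i = 0).
  by apply: sl' => li'; apply: ll'; rewrite li li' subrr.
apply: eq_bigr => i _; apply: (addIr (fmap F (l' i) (tagged (X i)))).
by rewrite -fmapD dsumDE dsumNE !subrK.
Qed.

Lemma lincomb_in A i (f : hom A (tag (X i))) :
  lincomb (@dsum_in _ (fun i => hom A (tag (X i))) i f) = fmap F f (tagged (X i)).
Proof.
rewrite (@lincombE _ _ [:: i]) ?big_seq1 ?dsum_inE // => j; rewrite inE => ij.
by apply/eqP; apply: contrapT => ji; apply: ij; rewrite dsum_in_neq //; exact: nesym.
Qed.

Lemma lincomb0 A : lincomb (0 : dsum (fun i => hom A (tag (X i)))) = 0.
Proof. by rewrite (@lincombE _ _ [::]) ?big_nil. Qed.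

Lemma span_lincomb (D : set I) A (x : F A) : span (X @` D) x <->
  exists2 l : dsum (fun i => hom A (tag (X i))),
    (forall i, l i <> 0 -> D i) & x = lincomb l.
Proof.
split=> [|[l lD ->{x}]].
  elim=> {A x} [A|A x y _ [l lD ->] _ [l' lD' ->]|A u f [i Di iu]].
  - by exists 0; rewrite ?lincomb0.
  - exists (l - l'); rewrite ?lincombB // => i; rewrite dsumDE dsumNE => ll'.
    have [li|/lD//] := pselect (l i = 0).
    by apply: lD' => li'; apply: ll'; rewrite li li' subrr.
  - case: u / iu f => f.
    exists (@dsum_in _ (fun i => hom A (tag (X i))) i f); last by rewrite lincomb_in.
    by move=> j; have [<-//|ij] := pselect (i = j); rewrite dsum_in_neq.
have [r ur rl] := dsum_support l; rewrite (lincombE ur) //.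
elim/big_rec: _ => [|i x _ Dx]; first exact: span0.
apply: spanD => //; have [->|/lD Di] := pselect (l i = 0).
  by rewrite fmap_hom0; exact: span0.
by apply: span_gen; exists i.
Qed.

(** Independence is stated through generated subfunctors because these pass to
subfamilies and along transformations without rewriting coordinates. *)
Definition independent := forall i A (f : hom A (tag (X i))),
  span (X @` [set~ i]) (fmap F f (tagged (X i))) -> f = 0.

Definition spanning := forall A (x : F A), span (range X) x.

Lemma lincomb_inj : independent -> forall A, injective (@lincomb A).
Proof.
move=> Xind A l l' ll'; apply: dsumP => i; apply/eqP; rewrite -subr_eq0; apply/eqP.
apply: Xind; apply/span_lincomb.
pose d := l - l'; have d0 : lincomb d = 0 by rewrite lincombB ll' subrr.
exists (@dsum_in _ (fun i => hom A (tag (X i))) i (d i) - d) => [j dj ij|].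
  by apply: dj; rewrite dsumDE dsumNE ij dsum_inE subrr.
by rewrite lincombB d0 subr0 lincomb_in.
Qed.

(** Existence of coordinates is generation.  Their uniqueness is independence:
two expressions of one element that differ at i express a multiple of the i-th
member, by a nonzero morphism, through the other members. *)
Lemma basisP : is_basis (fun i => tagged (X i)) <-> spanning /\ independent.
Proof.
split=> [Xb|[Xspan Xind] A x]; last first.
  have /span_lincomb [l _ ->] := Xspan A x.
  by exists l; split=> // l' /(lincomb_inj Xind).
split=> [A x|i A f /span_lincomb [l li fl]].
  by have [l [-> _]] := Xb A x; apply/span_lincomb; exists l.
have [l0 [_ l0u]] := Xb A (fmap F f (tagged (X i))).
have el : l0 = l by exact: l0u.
have : l0 = @dsum_in _ (fun i => hom A (tag (X i))) i f.
  by apply: l0u; exact/esym/lincomb_in.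
rewrite el => /(congr1 (fun l : dsum _ => l i)); rewrite dsum_inE => <-.
by apply: contrapT => /li /(_ erefl).
Qed.

End LinearCombinations.

Lemma nt_lincomb F G (a : nat_trans F G) I (X : I -> elt F) A
    (l : dsum (fun i => hom A (tag (X i)))) :
  a A (lincomb l) = lincomb (X := elt_map a \o X) l.
Proof.
have [r ur rl] := dsum_support l; rewrite (lincombE ur) // (lincombE ur) //.
by rewrite raddf_sum; apply: eq_bigr => i _; rewrite nt_natural.
Qed.

(** A basis may contain zero elements (at zero objects), whereas cardinalities
of bases are compared only in their absence. *)
Lemma basis_drop_zeros F : free_functor F -> exists I (X : I -> elt F),
  [/\ spanning X, independent X & forall i, tagged (X i) <> 0].
Proof.
move=> [I [A_ [x_ /(@basisP F I (fun i => Elt (x_ i))) [Xspan Xind]]]].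
exists {i | x_ i <> 0}, (fun i => Elt (x_ (sval i))); split=> [A x|i A f fi|[]//].
  apply: span_closed (Xspan A x) => _ [i _ <-] /=.
  have [->|xi] := pselect (x_ i = 0); first exact: span0.
  by apply: (@span_mem _ _ (Elt (x_ i))); exists (exist _ i xi).
apply: (Xind (sval i)); apply: span_mono fi => _ [j ji <-]; exists (sval j) => //.
by move=> /eq_sig_hprop e; apply: ji; apply: e => k; exact: Prop_irrelevance.
Qed.

End Span.

(** * Subfunctors and quotients *)

Section Subfunctors.
Variable C : preadditive.

Record subfunctor (F : functorAb C) := Subfunctor {
  sub_set :> forall A : C, set (F A);
  sub_set0 : forall A : C, sub_set (0 : F A);
  sub_setB : forall (A : C) (x y : F A),
    sub_set x -> sub_set y -> sub_set (x - y);
  sub_set_fmap : forall (A B : C) (f : hom A B) (x : F B),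
    sub_set x -> sub_set (fmap F f x) }.

Variables (F : functorAb C) (P : subfunctor F).

Section Objectwise.
Variable A : C.

Definition sub_pred : {pred F A} := fun x => `[< P A x >].

Lemma sub_predP x : reflect (P A x) (x \in sub_pred).
Proof. exact: asboolP. Qed.

Lemma sub_pred_zmod_closed : zmod_closed sub_pred.
Proof.
split=> [|x y /sub_predP Px /sub_predP Py]; apply/sub_predP.
  exact: sub_set0.
exact: sub_setB.
Qed.
HB.instance Definition _ :=
  GRing.isZmodClosed.Build (F A) sub_pred sub_pred_zmod_closed.

Record sub_elt := SubElt { sub_val : F A; _ : sub_val \in sub_pred }.
HB.instance Definition _ := [isSub for sub_val].
HB.instance Definition _ := [Choice of sub_elt by <:].
HB.instance Definition _ := [SubChoice_isSubZmodule of sub_elt by <:].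

Definition quo_elt := Quotient.quot sub_pred.
HB.instance Definition _ := GRing.Zmodule.on quo_elt.

Definition quo_pi : F A -> quo_elt := \pi_quo_elt.
Definition quo_repr : quo_elt -> F A := repr.

Lemma quo_reprK : cancel quo_repr quo_pi.
Proof. exact: reprK. Qed.

Lemma quo_pi_zmod : zmod_morphism quo_pi.
Proof. by move=> x y; rewrite /quo_pi raddfB. Qed.
HB.instance Definition _ :=
  GRing.isZmodMorphism.Build (F A) quo_elt quo_pi quo_pi_zmod.

Lemma quo_piP x : quo_pi x = 0 <-> P A x.
Proof.
split=> [x0|Px].
  apply/sub_predP; rewrite -[x]subr0 Quotient.idealrBE; apply/eqP.
  by rewrite -[LHS]/(quo_pi x) x0 -(raddf0 quo_pi).
rewrite -(raddf0 quo_pi); apply/eqP.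
by rewrite -[_ == _]Quotient.idealrBE subr0; apply/sub_predP.
Qed.

End Objectwise.

Section OnMorphisms.
Variables (A B : C) (f : hom A B).

Lemma sub_fmap_proof (x : sub_elt B) : fmap F f (sub_val x) \in @sub_pred A.
Proof. by case: x => x /= /sub_predP Px; apply/sub_predP/sub_set_fmap. Qed.

Definition sub_fmap (x : sub_elt B) : sub_elt A := SubElt (sub_fmap_proof x).
Lemma sub_fmap_zmod : zmod_morphism sub_fmap.
Proof. by move=> x y; apply: val_inj; rewrite /= raddfB. Qed.
HB.instance Definition _ :=
  GRing.isZmodMorphism.Build (sub_elt B) (sub_elt A) sub_fmap sub_fmap_zmod.

Definition quo_fmap (x : quo_elt B) : quo_elt A := quo_pi (fmap F f (quo_repr x)).

Lemma quo_fmap_pi x : quo_fmap (quo_pi x) = quo_pi (fmap F f x).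
Proof.
apply/eqP; rewrite -subr_eq0 -!raddfB; apply/eqP/quo_piP/sub_set_fmap/quo_piP.
by rewrite raddfB /= quo_reprK subrr.
Qed.

Lemma quo_fmap_zmod : zmod_morphism quo_fmap.
Proof.
move=> x y; rewrite -[x]quo_reprK -[y]quo_reprK -raddfB.
by rewrite !quo_fmap_pi !raddfB.
Qed.
HB.instance Definition _ :=
  GRing.isZmodMorphism.Build (quo_elt B) (quo_elt A) quo_fmap quo_fmap_zmod.

End OnMorphisms.

Program Definition sub_functor : functorAb C :=
  @FunctorAb C sub_elt (fun A B f => sub_fmap f : {additive _ -> _}) _ _ _.
Next Obligation. by apply: val_inj; rewrite /= fmap1. Qed.
Next Obligation. by apply: val_inj; rewrite /= fmapM. Qed.
Next Obligation. by apply: val_inj; rewrite /= fmapD. Qed.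

Program Definition quo_functor : functorAb C :=
  @FunctorAb C quo_elt (fun A B f => quo_fmap f : {additive _ -> _}) _ _ _.
Next Obligation. by rewrite -[x]quo_reprK quo_fmap_pi fmap1. Qed.
Next Obligation. by rewrite -[x]quo_reprK !quo_fmap_pi fmapM. Qed.
Next Obligation. by rewrite -[x]quo_reprK !quo_fmap_pi fmapD raddfD. Qed.

Program Definition sub_incl : nat_trans sub_functor F :=
  @NatTrans C sub_functor F (fun A => \val : {additive sub_elt A -> F A}) _.

Program Definition quo_proj : nat_trans F quo_functor :=
  @NatTrans C F quo_functor (fun A => @quo_pi A : {additive F A -> quo_elt A}) _.
Next Obligation. by rewrite quo_fmap_pi. Qed.

End Subfunctors.

(** * Bases of extensions *)

Section Extension.
Variables (C : preadditive) (F : functorAb C) (P : subfunctor F).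
Variables (I J : Type) (X : I -> elt (sub_functor P)).
Variable Y : J -> elt (quo_functor P).

Definition quo_lift (j : J) : elt F := Elt (quo_repr (tagged (Y j))).

Definition extension_family (s : I + J) : elt F :=
  match s with
  | inl i => elt_map (sub_incl P) (X i)
  | inr j => quo_lift j
  end.

Lemma quo_proj_incl A (x : sub_functor P A) : quo_proj P A (sub_incl P A x) = 0.
Proof. by apply/quo_piP; case: x => x /= /sub_predP. Qed.

Lemma elt_map_quo_lift j : elt_map (quo_proj P) (quo_lift j) = Y j.
Proof. by rewrite /elt_map /= quo_reprK; case: (Y j). Qed.

(** The coordinates of an element with respect to the lifts are those of its
image with respect to the independent family [Y]. *)
Lemma span_quo_lift_inj : independent Y ->
  forall A (x : F A), span (range quo_lift) x -> quo_proj P A x = 0 -> x = 0.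
Proof.
move=> Yind A x /span_lincomb [l _ ->]; rewrite nt_lincomb => l0.
suff -> : l = 0 by rewrite lincomb0.
apply: (lincomb_inj (X := Y) Yind); rewrite lincomb0 -[RHS]l0.
apply: eq_fsbigr => j _; congr (fmap _ _ _).
exact/esym/quo_reprK.
Qed.

Lemma extension_spanning : spanning X -> spanning Y -> spanning extension_family.
Proof.
move=> Xspan Yspan A x.
have : span (elt_map (quo_proj P) @` range quo_lift) (quo_proj P A x).
  apply: span_mono (Yspan _ _) => _ [j _ <-].
  by exists (quo_lift j); [exists j|rewrite elt_map_quo_lift].
move=> /span_image [z zspan] /eqP; rewrite -subr_eq0 -raddfB.
move=> /eqP/quo_piP/sub_predP Pzx.
rewrite -[x](subrK z) -(opprB z).
apply: spanD; last first.
  by apply: span_mono zspan => _ [j _ <-]; exists (inr j).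
apply: spanN; have : span (elt_map (sub_incl P) @` range X) (z - x).
  by apply/span_image; exists (SubElt Pzx) => //; exact: Xspan.
by apply: span_mono => _ [_ [i _ <-] <-]; exists (inl i).
Qed.

(** A relation involving a lifted element projects to a relation in the
quotient.  In a relation that expresses a multiple of an element of [X], the
part supported on the lifts projects to 0, hence vanishes. *)
Lemma extension_independent :
  independent X -> independent Y -> independent extension_family.
Proof.
move=> Xind Yind [i|j] A f /= fspan.
  have : span (elt_map (sub_incl P) @` (X @` [set~ i]) `|` range quo_lift)
      (fmap F f (sub_incl P _ (tagged (X i)))).
    apply: span_mono fspan => _ [[k|k] ki <-]; [left|right]; last by exists k.
    by exists (X k) => //; exists k => // ik; apply: ki; rewrite ik.
  move=> /span_setU [y [z [/span_image [x xspan xy] zspan yz]]].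
  have z0 : z = 0.
    apply: (span_quo_lift_inj Yind zspan).
    have -> : z = fmap F f (sub_incl P _ (tagged (X i))) - y.
      by rewrite yz addrC addKr.
    rewrite -nt_natural -xy -raddfB; exact: quo_proj_incl.
  apply: Xind; suff -> : fmap (sub_functor P) f (tagged (X i)) = x by [].
  by apply: val_inj; rewrite [RHS]xy -[RHS](addr0 y) -z0 -yz.
have : span (elt_map (quo_proj P) @` (extension_family @` [set~ inr j]))
    (quo_proj P A (fmap F f (quo_repr (tagged (Y j))))).
  by apply/span_image; eexists; first exact: fspan.
rewrite nt_natural [quo_proj P _ _]quo_reprK => Yspan; apply: Yind.
apply: span_closed Yspan => _ [_ [[i|k] kj <-] <-] /=.
  by rewrite [quo_pi _ _]quo_proj_incl; exact: span0.
by rewrite quo_reprK; apply: span_mem; exists k => // ek; apply: kj; rewrite ek.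
Qed.

End Extension.

(** * Functors over a division category *)

Section DivisionFunctors.
Variable C : preadditive.
Hypothesis C_iso : forall (A B : C) (f : hom A B), f <> 0 -> is_isom f.
Variable F : functorAb C.

(** The closure operator is stated over a choice type, since supports are
finite sequences. *)
Definition span_cl (S : set {classic elt F}) : set {classic elt F} :=
  [set t | span S (tagged t)].

Lemma span_unscale (S : set (elt F)) A B (f : hom A B) (x : F B) :
  f <> 0 -> span S (fmap F f x) -> span S x.
Proof.
move=> /C_iso [g [_ fg]] /(@span_fmap _ _ _ _ _ g).
by rewrite -fmapM fg fmap1.
Qed.

Lemma span_cl_exchange (S : set (elt F)) (x y : elt F) :
  span_cl (S `|` [set y]) x -> ~ span_cl S x -> span_cl (S `|` [set x]) y.
Proof.
move=> /span_setU [s [z [Ss /span_set1 [f ->] xE]]] nSx.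
apply: (@span_unscale _ _ _ f) => [f0|].
  by apply: nSx; rewrite /span_cl /= xE f0 fmap_hom0 addr0.
have -> : fmap F f (tagged y) = tagged x - s by rewrite xE addrC addKr.
apply: spanB; first by apply: span_mem; right.
by apply: span_mono Ss => t; left.
Qed.

Lemma independent_basis_set (I : Type) (X : I -> elt F) :
    spanning X -> independent X -> (forall i, tagged (X i) <> 0) ->
  injective X /\ basis_set span_cl (range (X : I -> {classic elt F})).
Proof.
move=> Xspan Xind X0.
have Xnspan i : ~ span (X @` [set~ i]) (tagged (X i)).
  have := Xind i _ (idm _); rewrite fmap1 => /[apply] id0; apply: (X0 i).
  by rewrite -[tagged _]fmap1 id0 fmap_hom0.
split=> [i j eX|].
  apply: contrapT => ij; apply: (Xnspan i); rewrite eX.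
  by apply: span_mem; exists j => // /esym.
split=> [_ [i _ <-] hi|]; last by rewrite -subTset => t _; exact: Xspan.
apply: (Xnspan i); apply: span_mono hi => _ [[j _ <-] ji].
by exists j => // e; apply: ji; rewrite e.
Qed.

Lemma division_free : free_functor F.
Proof.
have [] := @basis_set_exists {classic elt F} span_cl.
- by move=> S t; exact: span_mem.
- by move=> S R SR t; exact: span_closed.
- by move=> S t /span_finitary.
- exact: span_cl_exchange.
move=> B [Bind BT]; pose X (i : {t : elt F | B t}) := sval i.
exists {t : elt F | B t}, (fun i => tag (X i)), (fun i => tagged (X i)).
apply/basisP; split=> [A x|[t Bt] A f ft].
  have : span_cl B (Elt x) by rewrite BT.
  by apply: span_mono => t Bt; exists (exist _ t Bt).
apply: contrapT => f0; apply: (Bind t Bt); have := span_unscale f0 ft.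
apply: span_mono => _ [[u Bu] ut <-]; split=> //= e.
by apply: ut; exact: eq_exist.
Qed.

Lemma division_bases_equipotent : bases_equipotent F.
Proof.
move=> I J A_ B_ x_ y_.
move=> /(@basisP _ F I (fun i => Elt (x_ i))) [Xspan Xind].
move=> /(@basisP _ F J (fun j => Elt (y_ j))) [Yspan Yind] x0 y0.
have [Xinj Xb] := independent_basis_set Xspan Xind x0.
have [Yinj Yb] := independent_basis_set Yspan Yind y0.
have eX := @inj_card_eq I (elt F) [set: I] _ (in2W Xinj).
have eY := @inj_card_eq J (elt F) [set: J] _ (in2W Yinj).
rewrite -(card_eql eX) -(card_eqr eY).
apply: (@basis_set_card_eq {classic elt F} span_cl _ _ _ _ _ _ Xb Yb).
- by move=> S t; exact: span_mem.
- by move=> S R SR t; exact: span_closed.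
- by move=> S t /span_finitary.
- exact: span_cl_exchange.
Qed.

End DivisionFunctors.

(** * Freeness of all functors forces division *)

Section Cyclic.
Variables (C : preadditive) (F : functorAb C) (A : C) (x : F A).

Definition multiples (B : C) : set (F B) :=
  [set y | exists f : hom B A, y = fmap F f x].

Lemma multiples0 B : multiples (0 : F B).
Proof. by exists 0; rewrite fmap_hom0. Qed.

Lemma multiplesB B (y z : F B) : multiples y -> multiples z -> multiples (y - z).
Proof.
move=> [f ->] [g ->]; exists (f - g).
by apply: (addIr (fmap F g x)); rewrite -fmapD !subrK.
Qed.

Lemma multiples_fmap B D (f : hom B D) (y : F D) :
  multiples y -> multiples (fmap F f y).
Proof. by move=> [g ->]; exists (g \oc f); rewrite fmapM. Qed.

Definition cyclic_subfunctor : subfunctor F :=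
  Subfunctor multiples0 multiplesB multiples_fmap.

End Cyclic.

Section Converse.
Variable C : preadditive.

Lemma nonzero_source (A B : C) (f : hom A B) : f <> 0 -> nonzero_ob A.
Proof. by move=> f0 A0; apply: f0; rewrite -[f]compm1 A0 compm0. Qed.

Lemma nonzero_target (A B : C) (f : hom A B) : f <> 0 -> nonzero_ob B.
Proof. by move=> f0 B0; apply: f0; rewrite -[f]comp1m B0 comp0m. Qed.

(** A nonzero f has a right inverse g, which has a right inverse h in turn, and
then h = f. *)
Lemma right_inverses_division : (exists A : C, nonzero_ob A) ->
  (forall (A B : C) (f : hom A B), f <> 0 -> exists g, f \oc g = idm B) ->
  division_category C.
Proof.
move=> C0 rinv; split=> // A B f f0; have [g fg] := rinv _ _ _ f0.
have g0 : g <> 0.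
  by move=> g0; apply: f0; rewrite -[f]comp1m -fg g0 compm0 comp0m.
have [h gh] := rinv _ _ _ g0; exists g; split=> //.
by rewrite (_ : f = h) // -[LHS]compm1 -gh Defs.compA fg comp1m.
Qed.

Definition id_elt (B : C) : elt (representable B) :=
  @Elt _ (representable B) B (idm B).

Lemma id_spanning (B : C) :
  spanning (fun _ : unit => id_elt B).
Proof.
move=> A f; rewrite -[f]comp1m.
by apply: (@span_gen _ (representable B) _ A (id_elt B) f); exists tt.
Qed.

Lemma id_independent (B : C) :
  independent (fun _ : unit => id_elt B).
Proof.
move=> [] A f; rewrite (_ : _ @` _ = set0); last first.
  by apply/seteqP; split=> // ? [[] ut]; case: (ut erefl).
by move/span_set0; rewrite /= /precomp comp1m.
Qed.

(** The basis of hom(-,B) glued from bases of the multiples of f and of their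
quotient has as many elements as the basis formed by the identity of B. *)
Lemma division_of_free : (exists A : C, nonzero_ob A) ->
  (forall F : functorAb C, free_functor F /\ bases_equipotent F) ->
  division_category C.
Proof.
move=> C0 free; apply: right_inverses_division => // A B f f0.
pose P := @cyclic_subfunctor _ (representable B) A f.
have [I [X [Xspan Xind X0]]] := basis_drop_zeros (free (sub_functor P)).1.
have [J [Y [Yspan Yind Y0]]] := basis_drop_zeros (free (quo_functor P)).1.
have Wb : is_basis (fun s => tagged (extension_family X Y s)).
  apply/(basisP (extension_family X Y)).
  by split; [exact: extension_spanning|exact: extension_independent].
have W0 s : tagged (extension_family X Y s) <> 0.
  case: s => [i|j] /= e.
    by apply: (X0 i); exact: val_inj.
  by apply: (Y0 j); rewrite -[LHS]quo_reprK e raddf0.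
have idb := (basisP _).2 (conj (@id_spanning B) (@id_independent B)).
have id0 (u : unit) : idm B <> 0.
  exact: nonzero_target f0.
have := (free (representable B)).2 _ _ _ _ _ _ Wb idb W0 id0.
rewrite card_eq_le => /andP[/pcard_leP[h] _].
have unit1 (u v : unit) : u = v by case: u; case: v.
(* comparison with the one-element basis formed by the identity *)
have IJ1 (s t : I + J) : s = t.
  by apply: (@inj _ _ _ h); rewrite ?inE //; apply: unit1.
have [i _] : exists i : I, True.
  apply: contrapT => nI; apply: f0.
  have Pf : P A f by exists (idm A); rewrite /= /precomp compm1.
  have := Xspan A (SubElt (introT (sub_predP P f) Pf)).
  by rewrite (_ : range X = set0) => [/span_set0 /(congr1 val)//|];
    apply/seteqP; split=> // ? [i _ _]; apply: nI; exists i.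
have : P B (idm B).
  apply/quo_piP; have := Yspan B (quo_pi P (idm B)).
  rewrite (_ : range Y = set0) => [/span_set0//|].
  apply/seteqP; split=> // ? [j _ _].
  by have := IJ1 (inl i) (inr j).
by move=> [g ->]; exists g.
Qed.
End Converse.

(** * The graded ring of a category *)

Section Ring.
Variable C : preadditive.

Lemma graded_division_of_division :
  division_category C -> graded_division_ring (category_ring C).
Proof.
move=> [[A A0] iso]; split.
  exists (cring_one A : cring C) => /(congr1 (fun f : cring C => f (A, A))).
  by rewrite dsum_inE.
move=> [Y X] a ha a0; have /iso [b [ba ab]] : (a : cring C) (Y, X) <> 0.
  by move=> aYX; apply: a0; rewrite [a](cring_homogE ha) aYX;
     apply: dsumP => p; have [<-|Yp] := pselect ((Y, X) = p);
     rewrite ?dsum_inE ?dsum_in_neq.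
exists (@dsum_in _ (@cring_part C) (X, Y) b); split.
- exact: cring_homog_in.
- by rewrite [a](cring_homogE ha) /= cring_mul_in ab.
- by rewrite [a](cring_homogE ha) /= cring_mul_in ba.
Qed.

Lemma division_of_graded_division : (exists A : C, nonzero_ob A) ->
  graded_division_ring (category_ring C) -> division_category C.
Proof.
move=> C0 [_ inv]; split=> // A B f f0.
have fh := @cring_homog_in C (B, A) f.
have [|b [bh fb bf]] := inv (B, A) _ fh.
  by move=> /(congr1 (fun f : cring C => f (B, A))); rewrite dsum_inE.
pose g := (b : cring C) (A, B); exists g.
have bE : b = @dsum_in _ (@cring_part C) (A, B) g by exact: cring_homogE bh.
have: cring_mul (@dsum_in _ (@cring_part C) (B, A) f)
    (@dsum_in _ (@cring_part C) (A, B) g) = cring_one B by rewrite -bE.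
have: cring_mul (@dsum_in _ (@cring_part C) (A, B) g)
    (@dsum_in _ (@cring_part C) (B, A) f) = cring_one A by rewrite -bE.
rewrite !cring_mul_in.
move=> /(congr1 (fun f : cring C => f (A, A))) +
       /(congr1 (fun f : cring C => f (B, B))).
by rewrite !dsum_inE.
Qed.
End Ring.

(** * Semisimple categories *)

Section Semisimple.
Variable C : preadditive.
Implicit Types F G S : functorAb C.

Section Yoneda.
Variables (F : functorAb C) (A : C) (x : F A).
Definition yoneda_fun (B : C) (f : representable A B) : F B := fmap F f x.
Lemma yoneda_zmod B : zmod_morphism (@yoneda_fun B).
Proof.
move=> f g; apply: (addIr (yoneda_fun g)).
by rewrite /yoneda_fun -fmapD !subrK.
Qed.
HB.instance Definition _ B :=
  GRing.isZmodMorphism.Build (representable A B) (F B) (@yoneda_fun B) (@yoneda_zmod B).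
Lemma yoneda_natural B D (f : hom B D) (g : representable A D) :
  yoneda_fun (fmap (representable A) f g) = fmap F f (yoneda_fun g).
Proof. by rewrite /yoneda_fun -fmapM. Qed.
Definition yoneda : nat_trans (representable A) F :=
  @NatTrans C _ F (fun B => @yoneda_fun B : {additive _ -> _}) yoneda_natural.
End Yoneda.

(** Monomorphisms are tested on representable functors: by the Yoneda lemma
elements of [F] are transformations into [F]. *)
Lemma mono_injective F G (m : nat_trans F G) :
  nt_mono m <-> forall A, injective (m A).
Proof.
split=> [mono A x y xy|inj H a b ab A x]; last exact/(inj A)/ab.
have /(_ A (idm A)) : nt_eq (yoneda x) (yoneda y).
  by apply: mono => B f; rewrite /= /yoneda_fun !nt_natural xy.
by rewrite /= /yoneda_fun !fmap1.
Qed.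

Section Inverse.
Variables (F G : functorAb C) (m : nat_trans F G) (n : forall A, G A -> F A).
Hypotheses (m_inj : forall A, injective (m A)).
Hypothesis nK : forall A, cancel (@n A) (m A).

Definition nt_inv_fun A (y : G A) : F A := n y.
Lemma nt_inv_zmod A : zmod_morphism (@nt_inv_fun A).
Proof. by move=> x y; apply: m_inj; rewrite raddfB !nK. Qed.
HB.instance Definition _ A :=
  GRing.isZmodMorphism.Build (G A) (F A) (@nt_inv_fun A) (@nt_inv_zmod A).
Lemma nt_inv_natural A B (f : hom A B) (y : G B) :
  nt_inv_fun (fmap G f y) = fmap F f (nt_inv_fun y).
Proof. by apply: m_inj; rewrite nt_natural !nK. Qed.
Definition nt_inv : nat_trans G F :=
  @NatTrans C G F (fun A => @nt_inv_fun A : {additive _ -> _}) nt_inv_natural.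

Lemma nt_inv_isom : nt_isom m.
Proof.
by exists nt_inv; split=> A x; [apply: m_inj|]; rewrite /= nK.
Qed.
End Inverse.

Lemma bijective_isom F G (m : nat_trans F G) :
  (forall A, injective (m A)) -> (forall A y, exists x, m A x = y) -> nt_isom m.
Proof.
move=> minj msurj.
exact: (nt_inv_isom (n := fun A y => sval (cid (msurj A y))) minj
  (fun A y => svalP (cid (msurj A y)))).
Qed.

Lemma isom_surjective F G (m : nat_trans F G) :
  nt_isom m -> forall A y, exists x, m A x = y.
Proof. by move=> [n [_ mn]] A y; exists (n A y); exact: mn. Qed.

Lemma zero_nt_natural F G A B (f : hom A B) (x : F B) :
  (\0 : {additive F A -> G A}) (fmap F f x)
  = fmap G f ((\0 : {additive F B -> G B}) x).
Proof. by rewrite /= raddf0. Qed.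
Definition zero_nt F G : nat_trans F G :=
  @NatTrans C F G (fun A => \0 : {additive F A -> G A}) (@zero_nt_natural F G).

(** A nonzero element of a subfunctor of hom(-,A) is invertible, so that the
identity of A is a multiple of it. *)
Lemma division_representable_simple (A : C) :
  (forall (A B : C) (f : hom A B), f <> 0 -> is_isom f) -> nonzero_ob A ->
  simple_functor (representable A).
Proof.
move=> iso A0; split=> [/(_ A (idm A))//|G m /mono_injective minj].
have [|/existsNP[B /existsNP[x x0]]] := pselect (zero_functor G); first by left.
right; apply: bijective_isom => // D y.
have /iso[g [_ mg]] : m B x <> 0.
  by move=> mx; apply: x0; apply: minj; rewrite mx raddf0.
exists (fmap G y (fmap G g x)); rewrite !nt_natural /= /precomp.
by rewrite [X in X \oc y]mg comp1m.
Qed.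

Lemma division_semisimple : division_category C ->
  semisimple_category C /\
  forall A : C, nonzero_ob A -> division_ring (endo A).
Proof.
move=> [_ iso]; split=> A; last first.
  by move=> A0; split=> // f /iso [g [gf fg]]; exists g.
have [A0|A0] := pselect (nonzero_ob A).
  exists unit, (fun=> representable A), (fun=> nt_id _); split=> [_|G g].
    exact: division_representable_simple.
  exists (g tt); split=> [[]//|h hg B x]; exact: hg tt B x.
have {A0} A0 : idm A = 0 by apply: contrapT.
have hom0 B (f : hom B A) : f = 0 by rewrite -[f]comp1m A0 comp0m.
exists void, (fun=> representable A), (fun=> nt_id _); split=> [[]|G g].
exists (zero_nt _ G); split=> [[]|h _ B f].
by rewrite (hom0 B f) !raddf0.
Qed.

(** The components of the projections of a coproduct onto its summands. *)
Definition kronecker_nt (I : Type) (S : I -> functorAb C) i j :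
    nat_trans (S j) (S i) :=
  if pselect (j = i) is left e then ecast i (nat_trans (S j) (S i)) e (nt_id (S j))
  else zero_nt _ _.

Lemma kronecker_nt_diag (I : Type) (S : I -> functorAb C) i :
  kronecker_nt S i i = nt_id (S i).
Proof.
by rewrite /kronecker_nt; case: pselect => // e; rewrite (Prop_irrelevance e erefl).
Qed.

(** For a summand [S i] with injection [u i] and projection [p], the composite
of [p] and [u i] is left multiplication by an idempotent [c] of the division
ring of endomorphisms of [A].  It is nonzero because [S i] is, hence it is 1. *)
Lemma semisimple_representable_simple (A : C) :
    nonzero_ob A -> division_ring (endo A) ->
    semisimple_functor (representable A) ->
  exists (S : functorAb C) (u : nat_trans S (representable A))
    (p : nat_trans (representable A) S),
    simple_functor S /\ nt_eq (nt_comp u p) (nt_id _).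
Proof.
move=> A0 [_ Adiv] [I [S [u [Ssimple Scoprod]]]].
have [i _] : exists i : I, True.
  apply: contrapT => nI; have [h [_ hu]] := Scoprod _ u.
  have nI' (i : I) : False by apply: nI; exists i.
  have id_h := hu (nt_id _) (fun i => False_ind _ (nI' i)) A (idm A).
  have zero_h := hu (zero_nt _ _) (fun i => False_ind _ (nI' i)) A (idm A).
  by apply: A0; rewrite -[LHS]/(nt_id (representable A) A (idm A)) id_h -zero_h.
have [p [pu _]] := Scoprod _ (kronecker_nt S i).
have {}pu B (x : S i B) : p B (u i B x) = x.
  by have := pu i B x; rewrite kronecker_nt_diag.
pose c : endo A := u i A (p A (idm A)).
have upE B (f : hom B A) : u i B (p B f) = c \oc f.
  rewrite -[f in LHS]comp1m -[idm A \oc f]/(fmap (representable A) f (idm A)).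
  by rewrite !nt_natural.
have cc : c \oc c = c by rewrite -upE pu.
have c0 : c <> 0.
  move=> c0; have [/existsNP[B /existsNP[x x0]] _] := Ssimple i.
  have ux : u i B x = 0 by rewrite -[x]pu upE c0 comp0m.
  by apply: x0; rewrite -[x]pu ux raddf0.
have c1 : c = idm A.
  have [d [dc _]] := Adiv c c0.
  by rewrite -[LHS]comp1m -[idm A]dc -Defs.compA [c \oc c]cc.
exists (S i), (u i), p; split=> // B f.
by rewrite /= upE c1 comp1m.
Qed.

Lemma division_of_semisimple : (exists A : C, nonzero_ob A) ->
  semisimple_category C ->
  (forall A : C, nonzero_ob A -> division_ring (endo A)) ->
  division_category C.
Proof.
move=> C0 Css Cdiv; apply: right_inverses_division => // A B f f0.
have B0 := nonzero_target f0.
have [S [u [p [[_ Ssimple] up]]]] :=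
  semisimple_representable_simple B0 (Cdiv B B0) (Css B).
pose P := cyclic_subfunctor (p A f).
have Pf : P A (p A f) by exists (idm A); rewrite fmap1.
have Pmono : nt_mono (sub_incl P) by apply/mono_injective => D; exact: val_inj.
have [P0|/isom_surjective Piso] := Ssimple _ _ Pmono.
  have := P0 A (SubElt (introT (sub_predP P _) Pf)).
  move=> /(congr1 val) /= pf0; case: f0.
  by rewrite -[f]/(nt_id (representable B) A f) -up /= pf0 raddf0.
have [[x /sub_predP[g xE]] /= xid] := Piso B (p B (idm B)); exists g.
have := up B (idm B); rewrite /= -xid xE nt_natural => <-.
by rewrite [u A _]up.
Qed.

End Semisimple.

(** * Components of a division category *)

Section Components.
Variable C : preadditive.

Definition full_subcategory (P : C -> Prop) : preadditive :=
  @Preadditive {A : C | P A} (fun A B => hom (sval A) (sval B))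
    (fun A B D g f => g \oc f) (fun A => idm (sval A))
    (fun A B D E h g f => Defs.compA h g f)
    (fun A B f => comp1m f) (fun A B f => compm1 f)
    (fun A B D g g' f => compDl g g' f) (fun A B D g f f' => compDr g f f').

Program Definition full_inclusion (P : C -> Prop) :
    add_functor (full_subcategory P) C :=
  @AddFunctor (full_subcategory P) C (fun A => sval A)
    (fun A B => idfun : {additive hom (sval A) (sval B) -> hom (sval A) (sval B)}) _ _.

Definition linked (A : C) : set C := [set B | exists f : hom A B, f <> 0].

(** Zero objects are linked to no object.  They all join the component of a
chosen nonzero object [A0], so that every component has a nonzero object. *)
Definition component (A0 A : C) : set C :=
  if pselect (nonzero_ob A) then linked A else linked A0.

Section Division.
Hypothesis iso : forall (A B : C) (f : hom A B), f <> 0 -> is_isom f.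
Variable A0 : C.
Hypothesis A0_nz : nonzero_ob A0.

Lemma linked_refl A : nonzero_ob A -> linked A A.
Proof. by move=> A1; exists (idm A). Qed.

Lemma linked_trans A B D : linked A B -> linked B D -> linked A D.
Proof.
move=> [f f0] [g g0]; exists (g \oc f) => gf0; apply: f0.
have [h [hg _]] := iso g0.
by rewrite -[f]comp1m -hg -Defs.compA gf0 compm0.
Qed.

Lemma linked_sym A B : linked A B -> linked B A.
Proof.
move=> [f f0]; have [g [gf _]] := iso f0; exists g => g0.
by apply: (nonzero_source f0); rewrite -gf g0 comp0m.
Qed.

Lemma componentE A : nonzero_ob A -> component A0 A = linked A.
Proof. by rewrite /component; case: pselect. Qed.

Lemma linked_component A B : linked A B -> component A0 A = component A0 B.
Proof.
move=> AB; have [f f0] := AB.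
rewrite (componentE (nonzero_source f0)) (componentE (nonzero_target f0)).
apply/seteqP; split=> D; first by apply: linked_trans; exact: linked_sym.
exact: linked_trans.
Qed.

Lemma component_linked A B : nonzero_ob A -> nonzero_ob B ->
  component A0 A = component A0 B -> linked A B.
Proof.
move=> A1 B1; rewrite !componentE // => ->; exact: linked_refl.
Qed.

Lemma component_nonzero A : exists2 B, nonzero_ob B & component A0 B = component A0 A.
Proof.
have [A1|A1] := pselect (nonzero_ob A); first by exists A.
by exists A0 => //; rewrite componentE // /component; case: pselect.
Qed.

Definition component_category (j : range (component A0)) : preadditive :=
  full_subcategory (fun A => component A0 A = set_val j).

Lemma component_category_division j : division_category (component_category j).
Proof.
split=> [|A B f /iso]; last by [].
have [A _ jE] := set_valP j; have [B B1 eB] := component_nonzero A.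
by exists (exist _ B (etrans eB jE)).
Qed.

Lemma component_category_simple j : simple_category (component_category j).
Proof.
move=> K; split=> [[A [B [f [Kf f0]]]] X Y h|Kfull]; last first.
  have [[A A1] _] := component_category_division j.
  by exists A, A, (idm A); split=> //; exact: Kfull.
have [->|h0] := pselect (h = 0); first exact: ideal0.
have [u u0] : linked (sval X) (sval A).
  apply: component_linked; last by rewrite (svalP X) (svalP A).
    exact: (nonzero_source h0).
  exact: (nonzero_source f0).
have [v [vu _]] := iso u0; have [g [gf _]] := iso f0.
(* h factors as (h v g) f u, where u : X -> A, and v, g are inverse to u, f *)
have := @ideal_comp _ K X A B Y (h \oc v \oc g : hom (sval B) (sval Y)) f u Kf.
rewrite /= -[_ \oc g \oc f]Defs.compA gf compm1.
by rewrite -Defs.compA vu compm1.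
Qed.

Lemma component_coproduct : is_coproduct_category component_category C.
Proof.
exists (fun j => full_inclusion _); split=> [|j A B|i j A B ij f].
- pose k (A : C) : range (component A0) :=
    SigSub (mem_set (ex_intro2 _ _ A I erefl : range (component A0) (component A0 A))).
  exists (fun A => existT component_category (k A) (exist _ A erefl)) => [|//].
  move=> [j [A jA]] /=.
  have ej : k A = j by apply: val_inj.
  case: j / ej jA => jA; by congr existT; exact: eq_exist.
- by exists idfun.
- apply: contrapT => f0; apply: ij; apply: val_inj.
  rewrite -[LHS](svalP A) -[RHS](svalP B); apply: linked_component.
  by exists f.
Qed.

End Division.

Lemma division_of_coproduct (J : Type) (Cj : J -> preadditive) :
    (exists A : C, nonzero_ob A) -> (forall j, division_category (Cj j)) ->
    is_coproduct_category Cj C ->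
  division_category C.
Proof.
move=> C0 Cjdiv [incl [[ind indK Kind] full sep]]; split=> // A B.
rewrite -(Kind A) -(Kind B); case: (ind A) (ind B) => [i A'] [j B'] /= f f0.
have ij : i = j by apply: contrapT => ij; apply: f0; exact: sep.
case: j / ij in B' f f0 *; have [r _ rK] := full i A' B'.
have [|g [gf fg]] := (Cjdiv i).2 _ _ (r f).
  by move=> rf0; apply: f0; rewrite -[f]rK rf0 raddf0.
exists (fun_hom (incl i) _ _ g); rewrite -[f]rK -!fun_comp.
by rewrite gf fg !fun_id.
Qed.

End Components.

(** * The equivalence *)

Theorem proposition8p12 (C : preadditive)
    (hC : exists A : C, nonzero_ob A) :
  [<-> division_category C;
       graded_division_ring (category_ring C);
       forall F : functorAb C, free_functor F /\ bases_equipotent F;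
       semisimple_category C /\
         forall A : C, nonzero_ob A -> division_ring (endo A);
       exists (J : Type) (Cj : J -> preadditive),
         (forall j, simple_category (Cj j) /\ division_category (Cj j)) /\
         is_coproduct_category Cj C].
Proof.
have [A0 A0_nz] := hC.
tfae.
- exact: graded_division_of_division.
- move=> /(division_of_graded_division hC) [_ iso] F.
  by split; [exact: division_free|exact: division_bases_equipotent].
- by move=> /(division_of_free hC) /division_semisimple.
- move=> [Css Cdiv]; have [_ iso] := division_of_semisimple hC Css Cdiv.
  exists (range (component A0)), (@component_category C A0).
  split=> [j|]; last exact: component_coproduct.
  by split; [exact: component_category_simple|exact: component_category_division].
- move=> [J [Cj [Cjdiv CCj]]].
  by apply: (division_of_coproduct hC _ CCj) => j; exact: (Cjdiv j).2.
Qed.
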